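(* Let $\alpha>-1$ and let $f$ be an $\alpha$-harmonic function in $\mathbb{D}$ with $\sup_{z\in\mathbb{D}}|f(z)|\le M$, where $M$ is a constant. If $f$ has the series expansion $$f(z)=\sum_{k=0}^\infty c_kz^k+\sum_{k=1}^\infty c_{-k}P_{\alpha,k}(|z|^2)\overline{z}^{k}\qquad(z\in\mathbb{D}),$$ then for every $k\in\{0,1,2,\dots\}$, $$|c_k|\le M,$$ and for every $k\in\{1,2,\dots\}$, $$|c_k|+|c_{-k}|\,B(k,\alpha+1)\le\frac{4M}{\pi},$$ where $B(p,q)$ denotes the Beta function.
   Context: $\mathbb{D}=\{z\in\mathbb{C}:|z|<1\}$ and $\mathbb{T}=\partial\mathbb{D}$. Put $\frac{\partial}{\partial z}=\frac12\left(\frac{\partial}{\partial x}-i\frac{\partial}{\partial y}\right)$ and $\frac{\partial}{\partial\overline z}=\frac12\left(\frac{\partial}{\partial x}+i\frac{\partial}{\partial y}\right)$. For $\alpha>-1$, a complex-valued function $f$ is $\alpha$-harmonic in $\mathbb{D}$ if it is twice continuously differentiable in $\mathbb{D}$ and satisfies $\frac{\partial}{\partial z}\left((1-|z|^2)^{-\alpha}\frac{\partial f}{\partial\overline z}\right)=0$ in $\mathbb{D}$. Standing assumption: every $\alpha$-harmonic function $f$ considered has a boundary value $f^*\in\mathcal{D}'(\mathbb{T})$, in the sense that $f_r\to f^*$ in $\mathcal{D}'(\mathbb{T})$ as $r\to1^-$, where $f_r(e^{i\theta})=f(re^{i\theta})$, and is represented in $\mathbb{D}$ by the Poisson type integral (understood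 as a distributional pairing when $f^*$ is not a function) $$f(z)=\frac1{2\pi}\int_0^{2\pi}\mathcal{P}_\alpha(ze^{-i\theta})f^*(e^{i\theta})\,d\theta,\qquad \mathcal{P}_\alpha(z)=\frac{(1-|z|^2)^{\alpha+1}}{(1-z)(1-\overline z)^{\alpha+1}}.$$ For $k\ge1$ and $-1<x<1$, $P_{\alpha,k}(x)=\int_0^1t^{k-1}(1-tx)^\alpha\,dt$. By a known result of Olofsson and Wittsten, a function in $\mathbb{D}$ is $\alpha$-harmonic if and only if it has a convergent expansion of the form displayed in the claim, where $\{c_k\}_{k=-\infty}^\infty$ is a sequence of complex numbers with $\limsup_{|k|\to\infty}|c_k|^{1/|k|}\le1$. *)

(* Defs.v *)
From Stdlib Require Import Reals ZArith.
From Coquelicot Require Import Coquelicot.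

Local Open Scope R_scope.

Definition unit_disk (z : C) : Prop := Cmod z < 1.

Definition cis (t : R) : C := (cos t, sin t).

(** Integral of a complex-valued function of a real variable. *)
Definition CInt (g : R -> C) (a b : R) : C := @RInt C_R_CompleteNormedModule g a b.

(** * Differential operators on functions of [z = x + iy] *)

Definition dx (f : C -> C) (z : C) : C :=
  (Derive (fun t => Re (f (t, Im z))) (Re z),
   Derive (fun t => Im (f (t, Im z))) (Re z)).

Definition dy (f : C -> C) (z : C) : C :=
  (Derive (fun t => Re (f (Re z, t))) (Im z),
   Derive (fun t => Im (f (Re z, t))) (Im z)).

Definition dz (f : C -> C) (z : C) : C := (/ 2 * (dx f z - Ci * dy f z))%C.

Definition dzbar (f : C -> C) (z : C) : C := (/ 2 * (dx f z + Ci * dy f z))%C.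

(** [dx] and [dy] are total (with junk values where the partial derivatives do
    not exist), hence the explicit existence clauses. *)
Definition C1_disk (f : C -> C) : Prop :=
  forall z : C, unit_disk z ->
    ex_derive (fun t => Re (f (t, Im z))) (Re z) /\
    ex_derive (fun t => Im (f (t, Im z))) (Re z) /\
    ex_derive (fun t => Re (f (Re z, t))) (Im z) /\
    ex_derive (fun t => Im (f (Re z, t))) (Im z) /\
    continuous (dx f) z /\ continuous (dy f) z.

Definition C2_disk (f : C -> C) : Prop :=
  C1_disk f /\ C1_disk (dx f) /\ C1_disk (dy f).

Definition alpha_harmonic (alpha : R) (f : C -> C) : Prop :=
  C2_disk f /\
  forall z : C, unit_disk z ->
    dz (fun w => (RtoC (Rpower (1 - Cmod w ^ 2) (- alpha)) * dzbar f w)%C) z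
    = RtoC 0.

(** * Distributions on the unit circle *)

(** A function on the circle is represented by the corresponding 2pi-periodic
    function of the angle. *)
Definition test_function (phi : R -> C) : Prop :=
  (forall t, phi (t + 2 * PI) = phi t) /\
  (forall n t, ex_derive_n (fun s => Re (phi s)) n t /\
               ex_derive_n (fun s => Im (phi s)) n t).

Definition CDerive_n (phi : R -> C) (n : nat) (t : R) : C :=
  (Derive_n (fun s => Re (phi s)) n t, Derive_n (fun s => Im (phi s)) n t).

(** The last clause is continuity for the Frechet topology given by the
    seminorms [max_(j <= N) sup |phi^(j)|]. *)
Definition distribution (u : (R -> C) -> C) : Prop :=
  (forall phi psi, test_function phi -> test_function psi ->
     u (fun t => (phi t + psi t)%C) = (u phi + u psi)%C) /\
  (forall (a : C) phi, test_function phi ->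
     u (fun t => (a * phi t)%C) = (a * u phi)%C) /\
  (exists (N : nat) (K : R), forall phi (B : R), test_function phi ->
     (forall j t, (j <= N)%nat -> Cmod (CDerive_n phi j t) <= B) ->
     Cmod (u phi) <= K * B).

(** A function [g] on the circle is identified with the distribution
    [phi |-> int_0^{2pi} g(e^{it}) phi(e^{it}) dt], without the factor
    [1 / (2pi)]. *)
Definition boundary_value (f : C -> C) (u : (R -> C) -> C) : Prop :=
  forall phi, test_function phi ->
    filterlim (fun r : R => CInt (fun t => (f (RtoC r * cis t) * phi t)%C) 0 (2 * PI))
      (at_left 1) (locally (u phi)).

(** Principal branch of [w ^ s] for [Re w > 0], where the principal argument
    of [w] is [atan (Im w / Re w)]. *)
Definition cpower (w : C) (s : R) : C :=
  (RtoC (Rpower (Cmod w) s) * cis (s * atan (Im w / Re w)))%C.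

Definition poisson_kernel (alpha : R) (z : C) : C :=
  (RtoC (Rpower (1 - Cmod z ^ 2) (alpha + 1)) /
   ((1 - z) * cpower (1 - Cconj z) (alpha + 1)))%C.

Definition poisson_representation
    (alpha : R) (f : C -> C) (u : (R -> C) -> C) : Prop :=
  forall z : C, unit_disk z ->
    f z = (RtoC (/ (2 * PI)) * u (fun t => poisson_kernel alpha (z * cis (- t))))%C.

(** * Series expansion *)

Definition Pfun (alpha : R) (k : nat) (x : R) : R :=
  RInt (fun t => t ^ (k - 1) * Rpower (1 - t * x) alpha) 0 1.

(** [Rpower 0 y = 1] in the standard library, so 0 is treated separately. *)
Definition nth_root (n : nat) (x : R) : R :=
  if Req_EM_T x 0 then 0 else Rpower x (/ INR n).

(** [limsup_(|k| -> oo) |c_k|^(1/|k|) <= 1], grouping the indices [n] and [-n]. *)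
Definition coef_growth (c : Z -> C) : Prop :=
  Rbar_le
    (LimSup_seq (fun n => Rmax (nth_root n (Cmod (c (Z.of_nat n))))
                               (nth_root n (Cmod (c (- Z.of_nat n)%Z)))))
    (Finite 1).

Definition has_expansion (alpha : R) (f : C -> C) (c : Z -> C) : Prop :=
  coef_growth c /\
  forall z : C, unit_disk z ->
    exists S1 S2 : C,
      @is_series C_AbsRing C_NormedModule
        (fun k : nat => (c (Z.of_nat k) * z ^ k)%C) S1 /\
      @is_series C_AbsRing C_NormedModule
        (fun n : nat => let k := S n in
           (c (- Z.of_nat k)%Z * RtoC (Pfun alpha k (Cmod z ^ 2)) * Cconj z ^ k)%C)
        S2 /\
      f z = (S1 + S2)%C.

(** Euler's Beta function; the integral is improper at both end points. *)
Definition Beta (p q : R) : R :=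
  RInt_gen (fun t => Rpower t (p - 1) * Rpower (1 - t) (q - 1))
    (at_right 0) (at_left 1).

(* Main.v *)
Require Import Defs.
From Stdlib Require Import Reals ZArith Lra Lia.
From Coquelicot Require Import Coquelicot.

(** For fixed [r < 1] the expansion is the absolutely convergent Fourier series
    of [t |-> f(r e^{it})], with coefficients [c_k r^k] and
    [c_{-k} P_{alpha,k}(r^2) r^k]. Pairing a function bounded by [M] with
    [u e^{-ikt} + v e^{ikt}], [|u| = |v| = 1], whose modulus is [2 |cos (kt + d)|]
    with mean value [4 / pi], bounds the sum of the moduli of the two coefficients
    by [4 M / pi]. Finally let [r -> 1]: [P_{alpha,k}(r^2)] is at least, up to a
    factor tending to 1, the integral of [t^{k-1} (1-t)^alpha] over any [[a, b]]
    inside [(0, 1)], and [B(k, alpha + 1)] is the supremum of these integrals. *)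

Local Open Scope R_scope.

(** * Unimodular numbers and polar form *)

Lemma cis_plus (a b : R) : cis (a + b) = (cis a * cis b)%C.
Proof.
apply injective_projections; simpl; [apply cos_plus | rewrite sin_plus; ring].
Qed.

Lemma Cmod_cis (t : R) : Cmod (cis t) = 1.
Proof.
unfold Cmod, cis; simpl; rewrite !Rmult_1_r.
generalize (sin2_cos2 t); unfold Rsqr; intro E.
rewrite Rplus_comm, E; apply sqrt_1.
Qed.

Lemma cis_period (m : Z) (t : R) : cis (t + IZR m * (2 * PI)) = cis t.
Proof.
assert (H : forall (n : nat) x, cis (x + INR n * (2 * PI)) = cis x).
{ intros n x; unfold cis.
  replace (x + INR n * (2 * PI)) with (x + 2 * INR n * PI) by ring.
  now rewrite cos_period, sin_period. }
destruct (Z_le_gt_dec 0 m) as [Hm | Hm].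
- rewrite <- (Z2Nat.id m) by lia; rewrite <- INR_IZR_INZ; apply H.
- rewrite <- (H (Z.to_nat (- m)) (t + _)).
  rewrite INR_IZR_INZ, Z2Nat.id, opp_IZR by lia.
  f_equal; ring.
Qed.

Lemma polar (z : C) : exists t, z = (RtoC (Cmod z) * cis t)%C.
Proof.
destruct (Ceq_dec z 0) as [-> | Hz].
{ exists 0; rewrite Cmod_0; ring. }
assert (Hr := proj1 (Cmod_gt_0 z) Hz).
destruct z as [x y]; set (r := Cmod (x, y)) in *.
assert (Hxy : x ^ 2 + y ^ 2 = r ^ 2) by (unfold r; now rewrite Cmod2_alt).
assert (Hb : -1 <= x / r <= 1).
{ assert (Hx := re_le_Cmod (x, y)); fold r in Hx; simpl in Hx.
  apply Rabs_le_between in Hx.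
  split; [apply Rle_div_r | apply Rle_div_l]; lra. }
(* [acos] takes values in [0, PI], where the sine is nonnegative, so only [Rabs y] is recovered; the
   sign of [y] decides between [acos] and its opposite below. *)
assert (Hs : r * sin (acos (x / r)) = Rabs y).
{ rewrite sin_acos by exact Hb.
  rewrite <- (sqrt_Rsqr r) at 1 by lra; rewrite <- sqrt_mult_alt by apply Rle_0_sqr.
  rewrite <- sqrt_Rsqr_abs; f_equal; unfold Rsqr.
  replace (y * y) with (r ^ 2 - x ^ 2) by lra.
  field; lra. }
assert (Hc : r * cos (acos (x / r)) = x).
{ rewrite cos_acos by exact Hb; field; lra. }
destruct (Rle_dec 0 y) as [Hy | Hy].
- exists (acos (x / r)); rewrite Rabs_pos_eq in Hs by exact Hy.
  apply injective_projections; simpl; lra.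
- exists (- acos (x / r)); rewrite Rabs_left in Hs by lra.
  apply injective_projections; simpl; rewrite ?cos_neg, ?sin_neg; lra.
Qed.

(** * Trigonometric polynomials and bounds for their coefficients *)

Lemma is_RInt_cis (b : C) (m : Z) (N : nat) (sigma : R) : (1 <= N)%nat ->
  is_RInt (fun s => Re (b * cis (IZR m * ((s + sigma) / INR N)))) 0 (2 * PI * INR N)
    (if Z.eq_dec m 0 then 2 * PI * INR N * Re b else 0).
Proof.
intros HN; assert (HN' : 0 < INR N) by (apply lt_0_INR; lia).
destruct (Z.eq_dec m 0) as [-> | Hm].
- apply is_RInt_ext with (fun _ => Re b).
  { intros s _; unfold cis; simpl.
  rewrite Rmult_0_l, cos_0, sin_0; unfold Re; ring. }
  replace (2 * PI * INR N * Re b) with (scal (2 * PI * INR N - 0) (Re b))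
    by (unfold scal; simpl; unfold mult; simpl; ring).
  apply @is_RInt_const.
- assert (Hm' : IZR m <> 0) by now apply not_0_IZR.
  set (F := fun s => INR N / IZR m * Im (b * cis (IZR m * ((s + sigma) / INR N)))).
  replace 0 with (minus (F (2 * PI * INR N)) (F 0)) at 2.
  + apply @is_RInt_derive.
    * intros s _; unfold F; destruct b as [b1 b2]; unfold cis; simpl.
      auto_derive; [easy | unfold Rdiv; field; lra].
    * intros s _; destruct b as [b1 b2]; unfold cis; simpl.
      apply @ex_derive_continuous; auto_derive; easy.
  + unfold F.
    (* Over the whole range of [s] the angle advances by [2 PI m], so the primitive [F] takes equal
       values at both ends. *)
    replace (IZR m * ((2 * PI * INR N + sigma) / INR N))
      with (IZR m * ((0 + sigma) / INR N) + IZR m * (2 * PI)) by (field; lra).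
    rewrite cis_period; apply Rminus_diag_eq; reflexivity.
Qed.

Fixpoint trig_poly (a : Z -> C) (n : nat) (t : R) : C :=
  match n with
  | O => a 0%Z
  | S p => (trig_poly a p t
            + (a (Z.of_nat n) * cis (IZR (Z.of_nat n) * t)
               + a (- Z.of_nat n)%Z * cis (IZR (- Z.of_nat n) * t)))%C
  end.

(** By orthogonality only frequency [m] survives. Each induction step adds the shifted frequencies
    [j - m] and [- j - m], at most one of which is zero because [j] is positive. The free factor [u]
    serves to rotate [a m] onto the positive real axis. *)
Lemma trig_poly_pairing (a : Z -> C) (n : nat) (u : C) (m : Z) (N : nat) (sigma : R) :
  (1 <= N)%nat ->
  is_RInt (fun s => Re (trig_poly a n ((s + sigma) / INR N)
                        * (u * cis (IZR (- m) * ((s + sigma) / INR N)))))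
    0 (2 * PI * INR N)
    (if Z_le_dec (Z.abs m) (Z.of_nat n) then 2 * PI * INR N * Re (a m * u) else 0).
Proof.
intros HN; induction n as [ | n IH].
- eapply is_RInt_ext; [ | replace (if Z_le_dec _ _ then _ else _)
    with (if Z.eq_dec (- m) 0 then 2 * PI * INR N * Re (a 0%Z * u) else 0);
    [exact (is_RInt_cis (a 0%Z * u) (- m) N sigma HN) | ]].
  + intros s _; simpl trig_poly; apply (f_equal Re); ring.
  + destruct (Z.eq_dec (- m) 0), (Z_le_dec (Z.abs m) (Z.of_nat 0)); try lia; [ | easy].
    now replace m with 0%Z by lia.
- set (j := Z.of_nat (S n)).
  assert (H1 := is_RInt_cis (a j * u) (j - m) N sigma HN).
  assert (H2 := is_RInt_cis (a (- j)%Z * u) (- j - m) N sigma HN).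
  assert (H := is_RInt_plus _ _ _ _ _ _ IH (is_RInt_plus _ _ _ _ _ _ H1 H2)).
  eapply is_RInt_ext; [ | replace (if Z_le_dec _ _ then _ else _) with
    (plus (if Z_le_dec (Z.abs m) (Z.of_nat n) then 2 * PI * INR N * Re (a m * u) else 0)
      (plus (if Z.eq_dec (j - m) 0 then 2 * PI * INR N * Re (a j * u) else 0)
        (if Z.eq_dec (- j - m) 0 then 2 * PI * INR N * Re (a (- j)%Z * u) else 0)));
    [exact H | ]].
  + intros s _; set (t := (s + sigma) / INR N).
    change (Re (trig_poly a n t * (u * cis (IZR (- m) * t)))
      + (Re (a j * u * cis (IZR (j - m) * t)) + Re (a (- j)%Z * u * cis (IZR (- j - m) * t)))
      = Re ((trig_poly a n t + (a j * cis (IZR j * t) + a (- j)%Z * cis (IZR (- j) * t)))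
            * (u * cis (IZR (- m) * t)))).
    replace (IZR (j - m) * t) with (IZR j * t + IZR (- m) * t)
      by (rewrite minus_IZR, opp_IZR; ring).
    replace (IZR (- j - m) * t) with (IZR (- j) * t + IZR (- m) * t)
      by (rewrite minus_IZR, !opp_IZR; ring).
    rewrite !cis_plus.
    simpl; ring.
  + assert (Hj : j = (Z.of_nat n + 1)%Z) by (unfold j; lia).
    clearbody j; destruct (Z_le_dec (Z.abs m) (Z.of_nat n)), (Z.eq_dec (j - m) 0),
      (Z.eq_dec (- j - m) 0), (Z_le_dec (Z.abs m) j); try lia;
      unfold plus; simpl; try ring.
    * replace m with j by lia; ring.
    * replace m with (- j)%Z by lia; ring.
Qed.

(** Each arch contributes 2, so [|sin|] has mean [2 / PI]; this is the source of the constant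
    [4 / PI]. On the arch starting at [c = n PI] the sign of the sine is [cos c], which is 1 or
    -1. *)
Lemma is_RInt_abs_sin (n : nat) :
  is_RInt (fun s => Rabs (sin s)) 0 (INR n * PI) (2 * INR n).
Proof.
induction n as [ | n IH].
{ simpl; rewrite Rmult_0_l, Rmult_0_r; apply @is_RInt_point. }
rewrite S_INR; replace (2 * (INR n + 1)) with (plus (2 * INR n) 2)
  by (unfold plus; simpl; ring).
apply (@is_RInt_Chasles R_NormedModule) with (INR n * PI); [exact IH | ].
set (c := INR n * PI).
assert (H0 : sin c = 0) by (unfold c; rewrite INR_IZR_INZ; apply sin_eq_0_1; now exists (Z.of_nat n)).
assert (H1 : cos c * cos c = 1) by (generalize (sin2_cos2 c); unfold Rsqr; rewrite H0; lra).
replace ((INR n + 1) * PI) with (c + PI) by (unfold c; ring).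
apply is_RInt_ext with (fun s => cos c * sin s).
{ intros s Hs; rewrite Rmin_left, Rmax_right in Hs by (generalize PI_RGT_0; lra).
  change (cos c * sin s = Rabs (sin s)).
  replace s with ((s - c) + c) by ring.
  assert (Hp : 0 <= sin (s - c)) by (apply sin_ge_0; lra).
  rewrite sin_plus, H0.
  replace (cos c * (sin (s - c) * cos c + cos (s - c) * 0))
    with (sin (s - c) * (cos c * cos c)) by ring.
  replace (sin (s - c) * cos c + cos (s - c) * 0) with (sin (s - c) * cos c) by ring.
  rewrite H1, Rabs_mult, (Rabs_pos_eq _ Hp).
  replace (Rabs (cos c)) with 1; [ring | ].
  rewrite <- sqrt_Rsqr_abs; unfold Rsqr; rewrite H1; symmetry; apply sqrt_1. }
replace 2 with (minus (- (cos c * cos (c + PI))) (- (cos c * cos c))).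
2:{ unfold minus, plus, opp; simpl; rewrite neg_cos; lra. }
apply (@is_RInt_derive R_CompleteNormedModule (fun s => - (cos c * cos s))).
- intros s _; auto_derive; [easy | ring].
- intros s _; apply @ex_derive_continuous; auto_derive; easy.
Qed.

(** Pairing with [e^{-iA - imt}], where [A] is an argument of [a m], gives [2 PI |a m|], while the
    integrand is at most [M]. *)
Lemma trig_poly_coef_bound (a : Z -> C) (n : nat) (M : R) (m : Z) :
  (forall t, Cmod (trig_poly a n t) <= M) -> (Z.abs m <= Z.of_nat n)%Z ->
  Cmod (a m) <= M.
Proof.
intros HM Hm; assert (Hpi := PI_RGT_0).
destruct (polar (a m)) as [A HA].
assert (H := trig_poly_pairing a n (cis (- A)) m 1 0 (le_n 1)).
destruct (Z_le_dec _ _) as [_ | ]; [ | easy].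
assert (E : Re (a m * cis (- A)) = Cmod (a m)).
{ rewrite HA at 1; rewrite <- Cmult_assoc, <- cis_plus, Rplus_opp_r.
  unfold cis; rewrite cos_0, sin_0; simpl; ring. }
rewrite E in H; simpl INR in H.
assert (H' := is_RInt_le _ (fun _ => M) 0 (2 * PI * 1) _ _ ltac:(lra) H (is_RInt_const _ _ _)).
change (scal (2 * PI * 1 - 0) M) with ((2 * PI * 1 - 0) * M) in H'.
apply Rmult_le_reg_l with (2 * PI * 1); [lra | ].
apply Rle_trans with ((2 * PI * 1 - 0) * M); [apply H' | right; ring].
intros s _.
eapply Rle_trans; [apply Rle_abs | eapply Rle_trans; [apply re_le_Cmod | ]].
rewrite !Cmod_mult, !Cmod_cis, !Rmult_1_r; apply HM.
Qed.

(* With [a_k = |a_k| e^{iA}] and [a_{-k} = |a_{-k}| e^{iB}], test the polynomial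
   against [e^{-iA-ikt} + e^{-iB+ikt}], whose modulus is [2 |sin s|] after the
   change of variable [k t = s + sigma]. *)
Lemma trig_poly_coef_pair_bound (a : Z -> C) (n : nat) (M : R) (k : nat) :
  (forall t, Cmod (trig_poly a n t) <= M) -> (1 <= k <= n)%nat ->
  Cmod (a (Z.of_nat k)) + Cmod (a (- Z.of_nat k)%Z) <= 4 * M / PI.
Proof.
intros HM [Hk Hn]; assert (Hpi := PI_RGT_0).
assert (HK : 0 < INR k) by (apply lt_0_INR; lia).
set (m := Z.of_nat k).
destruct (polar (a m)) as [A HA], (polar (a (- m)%Z)) as [B HB].
(* The part [(B - A) / 2] makes the phases of the two test terms symmetric about [- (A + B) / 2];
   the part [PI / 2] turns the resulting cosine into a sine, so that [[0, 2 PI k]] splits into [2 k]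
   full arches. *)
set (sigma := PI / 2 + (B - A) / 2).
assert (H1 := trig_poly_pairing a n (cis (- A)) m k sigma Hk).
assert (H2 := trig_poly_pairing a n (cis (- B)) (- m) k sigma Hk).
destruct (Z_le_dec (Z.abs m) _) as [_ | ]; [ | lia].
destruct (Z_le_dec (Z.abs (- m)) _) as [_ | ]; [ | lia].
assert (E : forall z D, z = (RtoC (Cmod z) * cis D)%C -> Re (z * cis (- D)) = Cmod z).
{ intros z D HD; rewrite HD at 1; rewrite <- Cmult_assoc, <- cis_plus, Rplus_opp_r.
  unfold cis; rewrite cos_0, sin_0; simpl; ring. }
rewrite (E _ _ HA) in H1; rewrite (E _ _ HB) in H2.
assert (H3 := is_RInt_scal _ _ _ (2 * M) _ (is_RInt_abs_sin (2 * k))).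
rewrite mult_INR in H3; simpl (INR 2) in H3.
replace ((1 + 1) * INR k * PI) with (2 * PI * INR k) in H3 by ring.
assert (H := is_RInt_le _ _ 0 (2 * PI * INR k) _ _ ltac:(nra)
  (is_RInt_plus _ _ _ _ _ _ H1 H2) H3).
change (@plus R_NormedModule) with Rplus in H; change (@scal R_Ring R_NormedModule) with Rmult in H.
apply Rle_div_r; [easy | ].
apply Rmult_le_reg_l with (2 * INR k); [lra | ].
eapply Rle_trans; [ | eapply Rle_trans; [apply H | ]]; [right; ring | | right; ring].
clear H H1 H2 H3.
intros s _; set (t := (s + sigma) / INR k).
rewrite <- !cis_plus.
set (x := trig_poly a n t).
set (h := s + PI / 2).
assert (E1 : - A + IZR (- m) * t = - (A + B) / 2 - h).
{ unfold m, t, h, sigma; rewrite opp_IZR, <- INR_IZR_INZ; field; lra. }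
assert (E2 : - B + IZR (- - m) * t = - (A + B) / 2 + h).
{ unfold m, t, h, sigma; rewrite Z.opp_involutive, <- INR_IZR_INZ; field; lra. }
rewrite E1, E2.
(* Sum to product: [e^{-ih} + e^{ih} = 2 cos h], a real factor that leaves the real part. *)
replace (Re (x * cis (- (A + B) / 2 - h)) + Re (x * cis (- (A + B) / 2 + h)))
  with (Re (x * cis (- (A + B) / 2)) * (2 * cos h)).
2:{ unfold Rminus; rewrite !cis_plus; unfold cis; simpl; rewrite cos_neg, sin_neg; ring. }
replace (cos h) with (- sin s) by (unfold h; rewrite (sin_cos s), Rplus_comm; ring).
eapply Rle_trans; [apply Rle_abs | ].
rewrite Rabs_mult.
rewrite Rabs_mult, Rabs_Ropp, (Rabs_pos_eq 2) by lra.
assert (Hx : Rabs (Re (x * cis (- (A + B) / 2))) <= M).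
{ eapply Rle_trans; [apply re_le_Cmod | ].
  rewrite Cmod_mult, Cmod_cis, Rmult_1_r; apply HM. }
assert (0 <= Rabs (sin s)) by apply Rabs_pos.
nra.
Qed.

(** * From trigonometric polynomials to Fourier series *)

Lemma trig_poly_tail (a : Z -> C) (K rho : R) : 0 <= rho < 1 ->
  (forall n, Cmod (a (Z.of_nat n)) + Cmod (a (- Z.of_nat n)%Z) <= K * rho ^ n) ->
  forall n d t,
    Cmod (trig_poly a (n + d) t - trig_poly a n t) <= K * rho ^ n / (1 - rho).
Proof.
intros Hrho Ha n d t.
assert (HK : 0 <= K).
{ generalize (Ha O) (Cmod_ge_0 (a (Z.of_nat 0))) (Cmod_ge_0 (a (- Z.of_nat 0)%Z)); simpl; lra. }
assert (Hn : 0 <= rho ^ n) by (apply pow_le; lra).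
(* The exact finite geometric sum is the bound that passes through the induction on [d]. *)
apply Rle_trans with (K * rho ^ n * (1 - rho ^ d) / (1 - rho)).
2:{ apply Rmult_le_compat_r; [left; apply Rinv_0_lt_compat; lra | ].
    assert (0 <= rho ^ d) by (apply pow_le; lra).
    generalize (Rmult_le_pos _ _ HK Hn); nra. }
apply Rle_div_r; [lra | ].
induction d as [ | d IH].
- rewrite Nat.add_0_r; replace (trig_poly a n t - trig_poly a n t)%C with (RtoC 0) by ring.
  rewrite Cmod_0; simpl; lra.
- rewrite Nat.add_succ_r; set (m := S (n + d)).
  change (trig_poly a m t) with (trig_poly a (n + d) t
    + (a (Z.of_nat m) * cis (IZR (Z.of_nat m) * t)
       + a (- Z.of_nat m)%Z * cis (IZR (- Z.of_nat m) * t)))%C.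
  set (x := trig_poly a (n + d) t) in *; set (y := trig_poly a n t) in *.
  set (e := (a (Z.of_nat m) * cis (IZR (Z.of_nat m) * t)
             + a (- Z.of_nat m)%Z * cis (IZR (- Z.of_nat m) * t))%C).
  assert (He : Cmod e <= K * rho ^ m).
  { eapply Rle_trans; [apply Cmod_triangle | rewrite !Cmod_mult, !Cmod_cis, !Rmult_1_r; apply Ha]. }
  assert (Ht : Cmod (x + e - y) <= Cmod (x - y) + Cmod e).
  { replace (x + e - y)%C with ((x - y) + e)%C by ring; apply Cmod_triangle. }
  apply Rle_trans with ((Cmod (x - y) + Cmod e) * (1 - rho));
    [apply Rmult_le_compat_r; lra | ].
  apply Rle_trans with (K * rho ^ n * (1 - rho ^ d) + K * rho ^ m * (1 - rho)).
  { rewrite Rmult_plus_distr_r; apply Rplus_le_compat; [exact IH | ].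
    apply Rmult_le_compat_r; lra. }
  unfold m; simpl; rewrite pow_add.
  assert (H : 0 <= K * (rho ^ n * rho ^ d) * (1 - rho)).
  { repeat apply Rmult_le_pos; try lra; apply pow_le; lra. }
  nra.
Qed.

(** No integral of [g] is taken: the partial sums exceed [M] in modulus by at most a geometric tail
    uniform in [t], so the polynomial bounds apply to them, and the excess vanishes as the degree
    grows. *)
Lemma fourier_coef_bounds (a : Z -> C) (g : R -> C) (K rho M : R) : 0 <= rho < 1 ->
  (forall n, Cmod (a (Z.of_nat n)) + Cmod (a (- Z.of_nat n)%Z) <= K * rho ^ n) ->
  (forall t, filterlim (fun n => trig_poly a n t) eventually (locally (g t))) ->
  (forall t, Cmod (g t) <= M) ->
  (forall k : nat, Cmod (a (Z.of_nat k)) <= M) /\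
  (forall k : nat, (1 <= k)%nat ->
     Cmod (a (Z.of_nat k)) + Cmod (a (- Z.of_nat k)%Z) <= 4 * M / PI).
Proof.
intros Hrho Ha Hg HM; assert (Hpi := PI_RGT_0).
assert (HS : forall n t, Cmod (trig_poly a n t) <= M + K * rho ^ n / (1 - rho)).
{ intros n t; apply le_epsilon; intros eps Heps.
  assert (Hlim := proj1 (@filterlim_locally_ball_norm _ _ C_NormedModule _ _ _ _) (Hg t) (mkposreal eps Heps)).
  destruct Hlim as [N HN].
  specialize (HN (n + N)%nat ltac:(lia)).
  assert (HN' : Cmod (trig_poly a (n + N) t - g t) < eps) by exact HN.
  assert (Htail := trig_poly_tail a K rho Hrho Ha n N t).
  replace (trig_poly a n t) with
    (g t + ((trig_poly a (n + N) t - g t) - (trig_poly a (n + N) t - trig_poly a n t)))%C by ring.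
  eapply Rle_trans; [apply Cmod_triangle | ].
  specialize (HM t).
  assert (Cmod ((trig_poly a (n + N) t - g t) - (trig_poly a (n + N) t - trig_poly a n t))
          <= eps + K * rho ^ n / (1 - rho)).
  { unfold Cminus at 1; eapply Rle_trans; [apply Cmod_triangle | rewrite Cmod_opp; lra]. }
  lra. }
assert (Hl : forall k, is_lim_seq (fun n => M + K * rho ^ (n + k) / (1 - rho)) M).
{ intros k; replace (Finite M) with (Finite (M + K * 0 * / (1 - rho))) by (f_equal; ring).
  apply is_lim_seq_plus'; [apply is_lim_seq_const | ].
  apply is_lim_seq_mult'; [ | apply is_lim_seq_const].
  apply is_lim_seq_mult'; [apply is_lim_seq_const | ].
  apply (is_lim_seq_incr_n (fun n => rho ^ n)), is_lim_seq_geom.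
  rewrite Rabs_pos_eq; lra. }
split; intros k.
- apply (is_lim_seq_le (fun _ => Cmod (a (Z.of_nat k))) _ (Cmod (a (Z.of_nat k))) M)
    with (3 := Hl k); [ | apply is_lim_seq_const].
  intros n; apply trig_poly_coef_bound with (n + k)%nat; [apply HS | lia].
- intros Hk; set (s := _ + _).
  apply (is_lim_seq_le (fun _ => s) (fun n => 4 / PI * (M + K * rho ^ (n + k) / (1 - rho)))
           s (4 * M / PI)); [ | apply is_lim_seq_const | ].
  + intros n; replace (4 / PI * (M + K * rho ^ (n + k) / (1 - rho)))
      with (4 * (M + K * rho ^ (n + k) / (1 - rho)) / PI) by (unfold Rdiv; ring).
    apply trig_poly_coef_pair_bound with (n + k)%nat; [apply HS | lia].
  + replace (4 * M / PI) with (4 / PI * M) by (unfold Rdiv; ring).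
    apply is_lim_seq_mult'; [apply is_lim_seq_const | apply Hl].
Qed.

(** Convergent partial sums are bounded, and each term is a difference of two consecutive ones. *)
Lemma is_series_bounded (u : nat -> C) (l : C) :
  @is_series C_AbsRing C_NormedModule u l -> exists K, forall n, Cmod (u n) <= K.
Proof.
intros Hu.
destruct (@filterlim_bounded _ C_NormedModule (sum_n u) (ex_intro _ l Hu)) as [B HB].
assert (HB' : forall n, Cmod (sum_n (G := C_NormedModule) u n) <= B)
  by exact HB.
assert (0 <= B) by (apply Rle_trans with (2 := HB' O), Cmod_ge_0).
exists (B + B); intros [ | n].
- generalize (HB' O); rewrite sum_O; lra.
- assert (E := sum_Sn (G := C_NormedModule) u n).
  replace (u (S n)) with
    (sum_n (G := C_NormedModule) u (S n) + - sum_n (G := C_NormedModule) u n)%C.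
  2:{ rewrite E; change (@plus C_NormedModule) with Cplus; ring. }
  eapply Rle_trans; [apply Cmod_triangle | rewrite Cmod_opp].
  apply Rplus_le_compat; apply HB'.
Qed.

(** * Estimates for [Pfun] *)

(** The logarithms of [u] and [v] differ by at most [ln kappa]. The exponent [Rabs alpha] treats
    both signs of [alpha] at once. *)
Lemma Rpower_comparable (u v kappa alpha : R) : 0 < v <= u -> u <= kappa * v ->
  Rpower v alpha <= Rpower kappa (Rabs alpha) * Rpower u alpha /\
  Rpower u alpha <= Rpower kappa (Rabs alpha) * Rpower v alpha.
Proof.
intros [Hv Huv] Hk.
assert (Hk0 : 1 <= kappa) by nra.
assert (H1 : ln v <= ln u) by (apply ln_le; lra).
assert (H2 : ln u <= ln kappa + ln v)
  by (rewrite <- ln_mult by lra; apply ln_le; lra).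
unfold Rpower; rewrite <- !exp_plus.
assert (Ha := Rle_abs alpha); assert (Hb := Rle_abs (- alpha)); rewrite Rabs_Ropp in Hb.
assert (He : forall x y, x <= y -> exp x <= exp y).
{ intros x y [H | ->]; [left; now apply exp_increasing | now right]. }
split; apply He; nra.
Qed.

Lemma continuous_Pfun_integrand (alpha : R) (k : nat) (x t : R) : t * x < 1 ->
  continuous (fun t => t ^ (k - 1) * Rpower (1 - t * x) alpha) t.
Proof.
intros H; apply @ex_derive_continuous; unfold Rpower; auto_derive; lra.
Qed.

Lemma ex_RInt_Pfun (alpha : R) (k : nat) (x a b : R) : 0 <= x < 1 -> 0 <= a <= b -> b <= 1 ->
  ex_RInt (fun t => t ^ (k - 1) * Rpower (1 - t * x) alpha) a b.
Proof.
intros Hx Ha Hb; apply @ex_RInt_continuous; intros t.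
rewrite Rmin_left, Rmax_right by lra; intros Ht.
apply continuous_Pfun_integrand; nra.
Qed.

Lemma Pfun_integrand_ge_0 (alpha : R) (k : nat) (x t : R) : 0 <= t ->
  0 <= t ^ (k - 1) * Rpower (1 - t * x) alpha.
Proof.
intros Ht; apply Rmult_le_pos; [now apply pow_le | left; apply exp_pos].
Qed.

Lemma Pfun_ge_0 (alpha : R) (k : nat) (x : R) : 0 <= x < 1 -> 0 <= Pfun alpha k x.
Proof.
intros Hx; apply RInt_ge_0; [lra | apply ex_RInt_Pfun; lra | ].
intros t Ht; apply Pfun_integrand_ge_0; lra.
Qed.

(** For [t] in [0, 1], [1 - t y <= 1 - t x <= 1 <= (1 - t y) / (1 - y)]. The constant does not
    depend on [k], so bounds at one radius carry over to a smaller one uniformly in [k]. *)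
Lemma Pfun_comparable (alpha : R) (k : nat) (x y : R) : 0 <= x <= y -> y < 1 ->
  Pfun alpha k x <= Rpower (/ (1 - y)) (Rabs alpha) * Pfun alpha k y.
Proof.
intros Hx Hy; unfold Pfun.
change (Rmult (Rpower (/ (1 - y)) (Rabs alpha)))
  with (@scal R_Ring R_NormedModule (Rpower (/ (1 - y)) (Rabs alpha))).
rewrite <- (@RInt_scal R_CompleteNormedModule) by (apply ex_RInt_Pfun; lra).
apply RInt_le; [lra | apply ex_RInt_Pfun; lra | | ].
{ apply @ex_RInt_scal, ex_RInt_Pfun; lra. }
intros t Ht; change (@scal R_Ring R_NormedModule) with Rmult.
assert (H : Rpower (1 - t * x) alpha
            <= Rpower (/ (1 - y)) (Rabs alpha) * Rpower (1 - t * y) alpha).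
{ apply Rpower_comparable; [nra | ].
  apply Rmult_le_reg_l with (1 - y); [lra | ].
  rewrite <- Rmult_assoc, Rinv_r, Rmult_1_l by lra.
  assert (0 <= t * x) by (apply Rmult_le_pos; lra).
  assert (t * y <= y) by nra.
  nra. }
assert (0 <= t ^ (k - 1)) by (apply pow_le; lra).
change (t ^ (k - 1) * Rpower (1 - t * x) alpha <= Rpower (/ (1 - y)) (Rabs alpha) * (t ^ (k - 1) * Rpower (1 - t * y) alpha)).
rewrite <- Rmult_assoc, (Rmult_comm _ (t ^ _)), Rmult_assoc.
now apply Rmult_le_compat_l.
Qed.

(** For [t <= b], [1 - t x = (1 - t) + t (1 - x)] is at most [1 - t] times [1 + (1 - x) / (1 - b)],
    a factor tending to 1 as [x] tends to 1. Nonnegativity then enlarges [[a, b]] to [[0, 1]]. *)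
Lemma Pfun_ge_RInt (alpha : R) (k : nat) (x a b : R) : 0 <= x < 1 -> 0 < a < b -> b < 1 ->
  RInt (fun t => t ^ (k - 1) * Rpower (1 - t) alpha) a b
  <= Rpower (1 + (1 - x) / (1 - b)) (Rabs alpha) * Pfun alpha k x.
Proof.
intros Hx Ha Hb.
set (kappa := Rpower _ _); assert (Hk : 0 < kappa) by apply exp_pos.
set (F := fun t => t ^ (k - 1) * Rpower (1 - t * x) alpha).
assert (Hex : forall p q, 0 <= p <= q -> q <= 1 -> ex_RInt F p q)
  by (intros p q Hp Hq; apply ex_RInt_Pfun; lra).
assert (Hpos : forall p q, 0 <= p <= q -> q <= 1 -> 0 <= RInt F p q).
{ intros p q Hp Hq; apply RInt_ge_0; [lra | apply Hex; lra | ].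
  intros t Ht; apply Pfun_integrand_ge_0; lra. }
apply Rle_trans with (kappa * RInt F a b).
- change (Rmult kappa) with (@scal R_Ring R_NormedModule kappa).
  rewrite <- (@RInt_scal R_CompleteNormedModule) by (apply Hex; lra).
  apply RInt_le; [lra | | apply @ex_RInt_scal, Hex; lra | ].
  { apply @ex_RInt_continuous; intros t.
    rewrite Rmin_left, Rmax_right by lra; intros Ht.
    apply @ex_derive_continuous; unfold Rpower; auto_derive; lra. }
  intros t Ht; change (@scal R_Ring R_NormedModule) with Rmult; unfold F.
  assert (H : Rpower (1 - t) alpha <= kappa * Rpower (1 - t * x) alpha).
  { assert (t * x <= t) by nra.
    apply (fun Hv Hu => proj1 (Rpower_comparable (1 - t * x) _ _ alpha Hv Hu)); [lra | ].
    assert (Hq : (1 - x) / (1 - b) * (1 - t) >= 1 - x).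
    { apply Rle_ge; unfold Rdiv; rewrite Rmult_assoc; rewrite <- (Rmult_1_r (1 - x)) at 1.
      apply Rmult_le_compat_l; [lra | ].
      rewrite Rmult_comm; apply Rle_div_r; lra. }
    nra. }
  assert (0 <= t ^ (k - 1)) by (apply pow_le; lra).
  change (t ^ (k - 1) * Rpower (1 - t) alpha <= kappa * (t ^ (k - 1) * Rpower (1 - t * x) alpha)).
  rewrite <- Rmult_assoc, (Rmult_comm _ (t ^ _)), Rmult_assoc.
  now apply Rmult_le_compat_l.
- apply Rmult_le_compat_l; [lra | ].
  unfold Pfun; fold F.
  rewrite <- (@RInt_Chasles R_CompleteNormedModule F 0 a 1) by (apply Hex; lra).
  rewrite <- (@RInt_Chasles R_CompleteNormedModule F a b 1) by (apply Hex; lra).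
  change (@plus R_CompleteNormedModule) with Rplus.
  generalize (Hpos 0 a ltac:(lra) ltac:(lra)) (Hpos b 1 ltac:(lra) ltac:(lra)); lra.
Qed.

(** * One-sided limits and improper integrals *)

Lemma le_at_left_limit (g h : R -> R) (x y : R) : x < y -> continuous g y -> continuous h y ->
  (forall r, x < r < y -> g r <= h r) -> g y <= h y.
Proof.
intros Hxy Hg Hh H.
apply (@filterlim_le _ (at_left y) _ g h (g y) (h y)).
- assert (Hp : 0 < y - x) by lra.
  exists (mkposreal _ Hp); intros r Hr Hry; apply H.
  apply Rabs_lt_between' in Hr; simpl in Hr; lra.
- exact (filterlim_filter_le_1 (F := locally y) g (@filter_le_within R (locally y) _ _) Hg).
- exact (filterlim_filter_le_1 (F := locally y) h (@filter_le_within R (locally y) _ _) Hh).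
Qed.

(** The limit is the supremum [L] of the integrals over compact subintervals: once one of them is
    within [eps] of [L], so is the integral over every larger one, as [f] is nonnegative. *)
Lemma is_RInt_gen_of_bounded (f : R -> R) (a b D : R) : a < b ->
  (forall t, a < t < b -> 0 <= f t /\ continuous f t) ->
  (forall p q, a < p < q -> q < b -> RInt f p q <= D) ->
  exists L, is_RInt_gen f (at_right a) (at_left b) L /\ L <= D.
Proof.
intros Hab Hf HD.
assert (Hex : forall p q, a < p <= q -> q < b -> ex_RInt f p q).
{ intros p q Hp Hq; apply @ex_RInt_continuous; intros t.
  rewrite Rmin_left, Rmax_right by lra; intros Ht; apply Hf; lra. }
assert (Hpos : forall p q, a < p <= q -> q < b -> 0 <= RInt f p q).
{ intros p q Hp Hq; apply RInt_ge_0; [lra | now apply Hex | ].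
  intros t Ht; apply Hf; lra. }
set (E := fun y => exists p q, a < p < q /\ q < b /\ y = RInt f p q).
destruct (completeness E) as [L [HL1 HL2]].
{ exists D; intros y [p [q [H1 [H2 ->]]]]; now apply HD. }
{ exists (RInt f ((2 * a + b) / 3) ((a + 2 * b) / 3)), ((2 * a + b) / 3), ((a + 2 * b) / 3).
  repeat split; lra. }
exists L; split.
2:{ apply HL2; intros y [p [q [H1 [H2 ->]]]]; now apply HD. }
apply filterlimi_locally; intros eps.
assert (HE : exists p q, a < p < q /\ q < b /\ L - eps < RInt f p q).
{ apply Classical_Prop.NNPP; intros Hn.
  assert (L <= L - eps); [ | generalize (cond_pos eps); lra].
  apply HL2; intros y [p [q [H1 [H2 ->]]]].
  apply Rnot_lt_le; intros H3; apply Hn; exists p, q; repeat split; lra. }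
destruct HE as [p [q [Hp [Hq Hpq]]]].
exists (fun s => a < s < p) (fun s => q < s < b).
- assert (H : 0 < p - a) by lra; exists (mkposreal _ H); intros s Hs Has.
  apply Rabs_lt_between' in Hs; simpl in Hs; lra.
- assert (H : 0 < b - q) by lra; exists (mkposreal _ H); intros s Hs Hbs.
  apply Rabs_lt_between' in Hs; simpl in Hs; lra.
- intros s t Hs Ht; simpl; exists (RInt f s t); split.
  { apply @RInt_correct, Hex; lra. }
  apply Rabs_lt_between'.
  assert (RInt f s t <= L).
  { apply HL1; exists s, t; repeat split; lra. }
  assert (RInt f p q <= RInt f s t).
  { rewrite <- (@RInt_Chasles R_CompleteNormedModule f s p t) by (apply Hex; lra).
    rewrite <- (@RInt_Chasles R_CompleteNormedModule f p q t) by (apply Hex; lra).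
    change (@plus R_CompleteNormedModule) with Rplus.
    generalize (Hpos s p ltac:(lra) ltac:(lra)) (Hpos q t ltac:(lra) ltac:(lra)); lra. }
  generalize (cond_pos eps); lra.
Qed.

(** * The expansion as a Fourier series on a circle *)

Lemma trig_poly_series (a : Z -> C) (t : R) (S1 S2 : C) :
  @is_series C_AbsRing C_NormedModule
    (fun k => a (Z.of_nat k) * cis (INR k * t))%C S1 ->
  @is_series C_AbsRing C_NormedModule
    (fun n => a (- Z.of_nat (S n))%Z * cis (- INR (S n) * t))%C S2 ->
  filterlim (fun n => trig_poly a n t) eventually (locally (S1 + S2)%C).
Proof.
intros H1 H2.
set (A := fun k => (a (Z.of_nat k) * cis (INR k * t))%C) in *.
set (B := fun n => (a (- Z.of_nat (S n))%Z * cis (- INR (S n) * t))%C) in *.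
(* The indices are offset by one because the term [B n] carries frequency [-(n + 1)]. *)
assert (E : forall n, trig_poly a (S n) t
  = (sum_n (G := C_NormedModule) A (S n) + sum_n (G := C_NormedModule) B n)%C).
{ assert (Hi : forall m, IZR (- Z.of_nat m) = - INR m)
    by (intros m; now rewrite opp_IZR, <- INR_IZR_INZ).
  induction n as [ | n IH].
  - rewrite sum_Sn, !sum_O; change (@plus C_NormedModule) with Cplus.
    unfold A, B; cbn [trig_poly]; rewrite Hi, <- INR_IZR_INZ.
    replace (cis (INR 0 * t)) with (RtoC 1); [simpl Z.of_nat; ring | ].
    unfold cis; simpl INR; rewrite Rmult_0_l, cos_0, sin_0; reflexivity.
  - rewrite (sum_Sn (G := C_NormedModule) A (S n)), (sum_Sn (G := C_NormedModule) B n).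
    change (@plus C_NormedModule) with Cplus.
    change (trig_poly a (S (S n)) t) with (trig_poly a (S n) t
            + (a (Z.of_nat (S (S n))) * cis (IZR (Z.of_nat (S (S n))) * t)
               + a (- Z.of_nat (S (S n)))%Z * cis (IZR (- Z.of_nat (S (S n))) * t)))%C.
    rewrite IH, Hi, <- INR_IZR_INZ; unfold A, B; ring. }
assert (H : filterlim (fun n => trig_poly a (S n) t) eventually (locally (S1 + S2)%C)).
{ eapply filterlim_ext; [intros n; symmetry; apply E | ].
  apply (filterlim_comp_2 (G := locally S1) (H := locally S2)
    (fun n => sum_n (G := C_NormedModule) A (S n)) (sum_n (G := C_NormedModule) B) Cplus).
  - intros P HP; destruct (H1 P HP) as [N HN]; exists N; intros n Hn; apply HN; lia.
  - exact H2.
  - apply (@filterlim_plus C_AbsRing C_NormedModule). }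
intros P HP; destruct (H P HP) as [N HN].
exists (S N); intros [ | n] Hn; [lia | apply HN; lia].
Qed.

Lemma Cpow_polar (r t : R) (k : nat) :
  ((RtoC r * cis t) ^ k)%C = (RtoC (r ^ k) * cis (INR k * t))%C.
Proof.
induction k as [ | k IH].
- unfold cis; simpl; rewrite Rmult_0_l, cos_0, sin_0; apply injective_projections; simpl; ring.
- rewrite Cpow_S, IH, S_INR.
  replace ((INR k + 1) * t) with (t + INR k * t) by ring.
  rewrite cis_plus; simpl pow; rewrite RtoC_mult; ring.
Qed.

Lemma expansion_coef_bounds (alpha : R) (f : C -> C) (M : R) (c : Z -> C) (r : R) :
  has_expansion alpha f c -> (forall z, unit_disk z -> Cmod (f z) <= M) -> 0 < r < 1 ->
  (forall k : nat, Cmod (c (Z.of_nat k)) * r ^ k <= M) /\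
  (forall k : nat, (1 <= k)%nat ->
     (Cmod (c (Z.of_nat k)) + Cmod (c (- Z.of_nat k)%Z) * Pfun alpha k (r ^ 2)) * r ^ k
     <= 4 * M / PI).
Proof.
intros [_ Hc] HM Hr.
(* With these weights [a j = c j * w j] is the coefficient of [e^{ijt}] in the expansion of
   [f(r e^{it})]. *)
set (w := fun j => r ^ Z.abs_nat j * (if Z_le_dec 0 j then 1 else Pfun alpha (Z.abs_nat j) (r ^ 2))).
set (a := fun j => (c j * RtoC (w j))%C).
assert (Hw1 : forall n, w (Z.of_nat n) = r ^ n).
{ intros n; unfold w; rewrite Zabs2Nat.id; destruct (Z_le_dec _ _); [ring | lia]. }
assert (Hw2 : forall n, (1 <= n)%nat -> w (- Z.of_nat n)%Z = Pfun alpha n (r ^ 2) * r ^ n).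
{ intros n Hn; unfold w; replace (Z.abs_nat (- Z.of_nat n)) with n by lia.
  destruct (Z_le_dec _ _); [lia | ring]. }
assert (Hr2 : forall s, 0 < s < 1 -> 0 <= s ^ 2 < 1) by (intros s Hs; simpl; nra).
assert (Ha1 : forall n, Cmod (a (Z.of_nat n)) = Cmod (c (Z.of_nat n)) * r ^ n).
{ intros n; unfold a; rewrite Hw1, Cmod_mult, Cmod_R, Rabs_pos_eq; [easy | apply pow_le; lra]. }
assert (Ha2 : forall n, (1 <= n)%nat -> Cmod (a (- Z.of_nat n)%Z)
                 = Cmod (c (- Z.of_nat n)%Z) * (Pfun alpha n (r ^ 2) * r ^ n)).
{ intros n Hn; unfold a; rewrite Hw2, Cmod_mult, Cmod_R, Rabs_pos_eq; [easy | | easy].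
  apply Rmult_le_pos; [apply Pfun_ge_0, Hr2, Hr | apply pow_le; lra]. }
assert (Hz : forall s t, 0 < s -> Cmod (RtoC s * cis t) = s).
{ intros s t Hs; rewrite Cmod_mult, Cmod_cis, Cmod_R, Rabs_pos_eq; lra. }
(* Convergence at the intermediate radius [s] bounds the terms there, which gives geometric decay of
   ratio [r / s] at radius [r]. *)
set (s := (1 + r) / 2); assert (Hs : r < s < 1) by (unfold s; lra).
assert (Hgeom : exists K, forall n,
  Cmod (a (Z.of_nat n)) + Cmod (a (- Z.of_nat n)%Z) <= K * (r / s) ^ n).
{ destruct (Hc (RtoC s * cis 0)%C) as [S1 [S2 [H1 [H2 _]]]].
  { unfold unit_disk; rewrite Hz by lra; lra. }
  apply is_series_bounded in H1; apply is_series_bounded in H2.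
  destruct H1 as [K1 HK1], H2 as [K2 HK2].
  assert (HK1' : forall n, Cmod (c (Z.of_nat n)) * s ^ n <= K1).
  { intros n; specialize (HK1 n); rewrite Cmod_mult, Cmod_pow, Hz in HK1 by lra; exact HK1. }
  assert (HK2' : forall n, (1 <= n)%nat ->
    Cmod (c (- Z.of_nat n)%Z) * (Pfun alpha n (s ^ 2) * s ^ n) <= K2).
  { intros [ | n] Hn; [lia | ]; specialize (HK2 n); cbv beta zeta in HK2.
    rewrite Hz, !Cmod_mult, Cmod_pow, Cmod_conj, Hz, Cmod_R in HK2 by lra.
    rewrite Rabs_pos_eq in HK2; [rewrite <- Rmult_assoc; exact HK2 | apply Pfun_ge_0, Hr2; lra]. }
  clear HK1 HK2.
  set (kappa := Rpower (/ (1 - s ^ 2)) (Rabs alpha)); assert (Hk : 0 < kappa) by apply exp_pos.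
  assert (K1pos : 0 <= K1).
  { generalize (HK1' O) (Cmod_ge_0 (c (Z.of_nat 0))); simpl; lra. }
  assert (K2pos : 0 <= K2).
  { eapply Rle_trans; [ | apply (HK2' 1%nat); lia].
    apply Rmult_le_pos; [apply Cmod_ge_0 | apply Rmult_le_pos;
      [apply Pfun_ge_0, Hr2; lra | apply pow_le; lra]]. }
  assert (Hq : forall n, 0 <= (r / s) ^ n).
  { intros n; apply pow_le, Rlt_le, Rdiv_lt_0_compat; lra. }
  assert (Hrs : forall n, r ^ n = s ^ n * (r / s) ^ n).
  { intros n; rewrite <- Rpow_mult_distr; f_equal; field; lra. }
  assert (B1 : forall n, Cmod (a (Z.of_nat n)) <= K1 * (r / s) ^ n).
  { intros n; rewrite Ha1, Hrs, <- Rmult_assoc; now apply Rmult_le_compat_r. }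
  assert (B2 : forall n, (1 <= n)%nat -> Cmod (a (- Z.of_nat n)%Z) <= kappa * K2 * (r / s) ^ n).
  { intros n Hn; rewrite Ha2, (Hrs n), <- !Rmult_assoc by easy; apply Rmult_le_compat_r; [easy | ].
    assert (HP : Pfun alpha n (r ^ 2) <= kappa * Pfun alpha n (s ^ 2))
      by (apply Pfun_comparable; [simpl; nra | apply Hr2; lra]).
    eapply Rle_trans; [ | apply Rmult_le_compat_l; [lra | apply (HK2' n Hn)]].
    assert (Hcs : 0 <= Cmod (c (- Z.of_nat n)%Z) * s ^ n)
      by (apply Rmult_le_pos; [apply Cmod_ge_0 | apply pow_le; lra]).
    generalize (Rmult_le_compat_l _ _ _ Hcs HP); lra. }
  (* At [n = 0] the two indices coincide and [a 0] is counted twice, hence the factor 2. *)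
  exists (2 * K1 + kappa * K2); intros n.
  assert (H0 : 0 <= kappa * K2) by (apply Rmult_le_pos; lra).
  assert (B3 : Cmod (a (- Z.of_nat n)%Z) <= K1 * (r / s) ^ n + kappa * K2 * (r / s) ^ n).
  { destruct n as [ | n].
    - generalize (B1 O); simpl; lra.
    - generalize (B2 (S n) ltac:(lia)) (Rmult_le_pos _ _ K1pos (Hq (S n))); lra. }
  generalize (B1 n); lra. }
destruct Hgeom as [K HK].
destruct (fourier_coef_bounds a (fun t => f (RtoC r * cis t)%C) K (r / s) M) as [F1 F2].
- split; [apply Rlt_le, Rdiv_lt_0_compat; lra | apply Rlt_div_l; lra].
- exact HK.
- intros t; destruct (Hc (RtoC r * cis t)%C) as [S1 [S2 [H1 [H2 ->]]]].
  { unfold unit_disk; rewrite Hz by lra; lra. }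
  apply trig_poly_series.
  + refine (is_series_ext _ _ _ _ H1).
    intros n; rewrite Cpow_polar; unfold a; rewrite Hw1; change (@eq C_NormedModule) with (@eq C); ring.
  + refine (is_series_ext _ _ _ _ H2).
    intros n; cbv zeta; change (@eq C_NormedModule) with (@eq C).
    rewrite Hz by lra; unfold a; rewrite Hw2 by lia.
    replace (Cconj (RtoC r * cis t)) with (RtoC r * cis (- t))%C.
    2:{ unfold cis; rewrite cos_neg, sin_neg; apply injective_projections; simpl; ring. }
    rewrite Cpow_polar, RtoC_mult.
    replace (- INR (S n) * t) with (INR (S n) * - t) by ring; ring.
- intros t; apply HM; unfold unit_disk; rewrite Hz; lra.
- split; intros k; [rewrite <- Ha1; apply F1 | intros Hk].
  rewrite Rmult_plus_distr_r, Rmult_assoc, <- Ha1, <- Ha2 by easy; now apply F2.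
Qed.

(** * The limit [r -> 1] and the Beta function *)

Lemma expansion_coef_incomplete_Beta_bound (alpha : R) (f : C -> C) (M : R) (c : Z -> C)
    (k : nat) (a b : R) :
  has_expansion alpha f c -> (forall z, unit_disk z -> Cmod (f z) <= M) ->
  (1 <= k)%nat -> 0 < a < b -> b < 1 ->
  Cmod (c (Z.of_nat k))
  + Cmod (c (- Z.of_nat k)%Z) * RInt (fun t => t ^ (k - 1) * Rpower (1 - t) alpha) a b
  <= 4 * M / PI.
Proof.
intros Hc HM Hk Ha Hb.
set (I := RInt _ a b).
set (A := Cmod (c (Z.of_nat k))); set (B := Cmod (c (- Z.of_nat k)%Z)).
assert (HA : 0 <= A) by apply Cmod_ge_0; assert (HB : 0 <= B) by apply Cmod_ge_0.
set (kappa := fun r => Rpower (1 + (1 - r ^ 2) / (1 - b)) (Rabs alpha)).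
(* Both sides become values at 1 of continuous functions of [r], with [kappa 1 = 1]; the inequality
   is then proved for [r < 1]. *)
replace (A + B * I) with ((fun r => (A + B * I) * r ^ k) 1) by (cbv beta; rewrite pow1; ring).
replace (4 * M / PI) with ((fun r => kappa r * (4 * M / PI)) 1).
2:{ unfold kappa, Rpower; simpl; replace (1 + (1 - 1 * (1 * 1)) / (1 - b)) with 1 by (field; lra).
    rewrite ln_1, Rmult_0_r, exp_0; ring. }
apply (le_at_left_limit (fun r => (A + B * I) * r ^ k) (fun r => kappa r * (4 * M / PI)) 0 1); [lra | | | ].
- apply @ex_derive_continuous; auto_derive; easy.
- apply @ex_derive_continuous; unfold kappa, Rpower; auto_derive.
  replace (1 + (1 - 1 * (1 * 1)) * / (1 - b)) with 1 by (field; lra); lra.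
- intros r Hr.
  destruct (expansion_coef_bounds alpha f M c r Hc HM Hr) as [_ H].
  specialize (H k Hk); fold A B in H.
  assert (Hr2 : 0 <= r ^ 2 < 1) by (simpl; nra).
  assert (HI : I <= kappa r * Pfun alpha k (r ^ 2)) by (apply Pfun_ge_RInt; lra).
  (* The factor [kappa r] lost on the integral multiplies [A] as well, which is harmless since it is
     at least 1. *)
  assert (Hone : 1 <= kappa r).
  { assert (Hq : 0 < (1 - r ^ 2) / (1 - b)) by (apply Rdiv_lt_0_compat; lra).
    apply Rle_trans with (Rpower (1 + (1 - r ^ 2) / (1 - b)) 0).
    - rewrite Rpower_O; lra.
    - apply Rle_Rpower; [lra | apply Rabs_pos]. }
  apply Rle_trans with (kappa r * ((A + B * Pfun alpha k (r ^ 2)) * r ^ k)).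
  + rewrite <- Rmult_assoc; apply Rmult_le_compat_r; [apply pow_le; lra | ].
    generalize (Rmult_le_compat_l _ _ _ HB HI) (Rmult_le_compat_r _ _ _ HA Hone); lra.
  + apply Rmult_le_compat_l; lra.
Qed.

Theorem theorem1p2 (alpha : R) (halpha : -1 < alpha)
    (f : C -> C) (hf : alpha_harmonic alpha f)
    (fstar : (R -> C) -> C) (hfstar : distribution fstar)
    (hbv : boundary_value f fstar)
    (hpoisson : poisson_representation alpha f fstar)
    (M : R) (hM : forall z : C, unit_disk z -> Cmod (f z) <= M)
    (c : Z -> C) (hc : has_expansion alpha f c) :
  (forall k : nat, Cmod (c (Z.of_nat k)) <= M) /\
  (forall k : nat, (1 <= k)%nat ->
     Cmod (c (Z.of_nat k)) + Cmod (c (- Z.of_nat k)%Z) * Beta (INR k) (alpha + 1)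
     <= 4 * M / PI).
Proof.
split.
- intros k.
  replace (Cmod (c (Z.of_nat k))) with ((fun r => Cmod (c (Z.of_nat k)) * r ^ k) 1)
    by (cbv beta; rewrite pow1; ring).
  apply (le_at_left_limit (fun r => Cmod (c (Z.of_nat k)) * r ^ k) (fun _ => M) 0 1); [lra | | | ].
  + apply @ex_derive_continuous; auto_derive; easy.
  + apply continuous_const.
  + intros r Hr; now apply (expansion_coef_bounds alpha f M c r hc hM Hr).
- intros k Hk.
  set (A := Cmod (c (Z.of_nat k))); set (B := Cmod (c (- Z.of_nat k)%Z)).
  set (phi := fun t => Rpower t (INR k - 1) * Rpower (1 - t) (alpha + 1 - 1)).
  assert (Hint : forall a b, 0 < a < b -> b < 1 -> A + B * RInt phi a b <= 4 * M / PI).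
  { intros a b Ha Hb.
    rewrite (RInt_ext phi (fun t => t ^ (k - 1) * Rpower (1 - t) alpha)).
    - now apply (expansion_coef_incomplete_Beta_bound alpha f).
    - intros t; rewrite Rmin_left, Rmax_right by lra; intros Ht.
      unfold phi; rewrite <- Rpower_pow, minus_INR by (lra || lia).
      replace (alpha + 1 - 1) with alpha by ring; reflexivity. }
  assert (Hphi : forall t, 0 < t < 1 -> 0 <= phi t /\ continuous phi t).
  { intros t Ht; split.
    - apply Rmult_le_pos; left; apply exp_pos.
    - apply @ex_derive_continuous; unfold phi, Rpower; auto_derive; lra. }
  assert (HB : 0 <= B) by apply Cmod_ge_0.
  (* If [B] vanishes, the Beta term drops out and the bound on any one interval suffices. Otherwise
     division by [B] bounds all the incomplete integrals, which yields both convergence of the Beta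
     integral and its bound. *)
  destruct (Req_dec B 0) as [HB0 | HB0].
  { specialize (Hint (/ 3) (/ 2) ltac:(lra) ltac:(lra)); rewrite HB0 in *; lra. }
  destruct (is_RInt_gen_of_bounded phi 0 1 ((4 * M / PI - A) / B)) as [L [HL HLD]];
    [lra | exact Hphi | | ].
  { intros p q Hp Hq; apply Rle_div_r; [lra | ].
    specialize (Hint p q Hp Hq); lra. }
  unfold Beta; fold phi.
  rewrite (is_RInt_gen_unique _ _ HL).
  apply Rle_div_r in HLD; lra.
Qed.
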